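(* Let $k$ be a positive integer, and let $g_k\in \mathrm{H}_2$ be the element with trivial shift which interchanges $-j$ and $j$ for every $1\le j\le k$ and whose permutation part fixes all other nonzero integers, i.e. $g_k=\big((-k,k)(-(k-1),k-1)\cdots(-2,2)(-1,1)\big)_0$. Then $g_k$ is a dead end of strong depth at least $k$ in the Houghton group $\mathrm{H}_2$ with respect to the generating set $X=\{s,\sigma\}$.
   Context: The Houghton group $\mathrm{H}_2$: let $*^2=\{(k,l) : k\in\mathbb{N},\ l\in\{1,2\}\}$ with $\mathbb{N}=\{0,1,2,\dots\}$. $\mathrm{H}_2$ is the group of all permutations $\phi$ of $*^2$ for which there exist constants $s(1),s(2)\in\mathbb{Z}$ such that $\phi(k,l)=(k+s(l),l)$ for all but finitely many $(k,l)$. Points of $*^2$ are labelled by nonzero integers: $(j-1,1)$ is labelled $-j$ and $(j-1,2)$ is labelled $j$, for $j\ge1$; so $\mathrm{H}_2$ acts on $\mathbb{Z}\setminus\{0\}$. The generator $s\in \mathrm{H}_2$ is the shift by one step to the right along the nonzero integers: $s(k,1)=(k-1,1)$ for $k\ge1$, $s(0,1)=(0,2)$, $s(k,2)=(k+1,2)$; in labels, $s(-1)=1$ and $s(i)=i+1$ for $i\ne -1$. The generator $\sigma$ is the transposition interchanging $(0,1)$ and $(0,2)$, i.e. $-1$ and $1$. The set $X=\{s,\sigma\}$ generates $\mathrm{H}_2$. Every element of $\mathrm{H}_2$ is written uniquely as $(\omega)_t$, meaning a finitely supported permutation $\omega$ of $\mathbb{Z}\setminus\{0\}$ followed by the shift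 $s^t$, $t\in\mathbb{Z}$; ''trivial shift'' means $t=0$. Dead ends: for a group $G$ with finite generating set $X$, the Cayley graph $\Gamma$ has vertex set $G$ and edges the pairs $(g_1,g_2)$ with $g_1^{-1}g_2\in X^{\pm1}$, and $d=d_X$ is the resulting path (word) metric. $B_g(r)=\{h\in G: d(g,h)\le r\}$. An element $g$ with $n=d(1,g)$ is a dead end with respect to $X$ if $B_g(1)\subseteq B_1(n)$. Strong depth: for a dead end $g$ with $d(1,g)=n$, the strong depth of $g$ is the minimal number $m$ such that $g$ can be connected to a point of $\Gamma\setminus B_1(n)$ inside $\Gamma\setminus B_1(n-m)$, i.e. such that there is an edge path in $\Gamma$ starting at $g$ and ending at a vertex at distance greater than $n$ from $1$, all of whose vertices have distance greater than $n-m$ from $1$.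
   Formalization: The theorem is proved for k ≥ 2 instead of every positive k: for k = 1 the element g_1 = σ has length 1 and its neighbour σs has length 2, so g_1 is not a dead end and the claim fails. *)

(* Defs.v *)
From HB Require Import structures.
From mathcomp Require Import all_boot all_order all_algebra.
From mathcomp Require Import zify.
From mathcomp Require Import boolp classical_sets functions cardinality.

Set Implicit Arguments.
Unset Strict Implicit.
Unset Printing Implicit Defensive.

Import GRing.Theory.

Local Open Scope group_scope.

Section CayleyGraph.
Variables (G : groupType) (X : seq G).
Implicit Types (g h v : G) (p : seq G) (n m : nat) (r : int).

Definition cayley_edge : rel G :=
  fun g h => (g^-1 * h \in X) || ((g^-1 * h)^-1 \in X).

(* An edge path starting at g is given by the sequence p of its remaining
   vertices: it ends at [last g p] and has length [size p]. *)
Definition edge_path g p h : Prop := path cayley_edge g p /\ last g p = h.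

(* d(g, h) = n.  The distance is a relation, so that no value has to be invented
   for vertices in different components when X does not generate G. *)
Definition cayley_dist g h n : Prop :=
  (exists2 p, edge_path g p h & size p = n) /\
  (forall p, edge_path g p h -> n <= size p).

(* B_g(r).  The radius is an integer: the ball is empty when r < 0, which is
   what makes n - m meaningful below when m > n. *)
Definition cayley_ball g r h : Prop :=
  exists2 n, cayley_dist g h n & (n%:Z <= r)%R.

Definition dead_end g : Prop :=
  exists2 n, cayley_dist 1 g n &
    forall h, cayley_ball g 1%R h -> cayley_ball 1 n%:Z h.

(* g, at distance n from 1, can be connected to the complement of B_1(n) inside
   the complement of B_1(n - m). *)
Definition escapes g n m : Prop :=
  exists p h, [/\ edge_path g p h,
    ~ cayley_ball 1 n%:Z h
  & forall v, v \in g :: p -> ~ cayley_ball 1 (n%:Z - m%:Z)%R v].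

Definition strong_depth g m : Prop :=
  exists2 n, cayley_dist 1 g n &
    escapes g n m /\ (forall m', escapes g n m' -> m <= m').

End CayleyGraph.

(* The set of points of the two rays; the Boolean is the ray, [false] for l = 1
   and [true] for l = 2. *)
Notation point := (nat * bool)%type.

(* The identification of the points with the nonzero integers. *)
Definition label (x : point) : int :=
  (if x.2 then x.1.+1%:Z else - x.1.+1%:Z)%R.

Definition eventual_translation (f : point -> point) : Prop :=
  exists s : bool -> int,
    finite_set [set x : point |
      ~ ((f x).2 = x.2 /\ ((f x).1%:Z = x.1%:Z + s x.2)%R)]%classic.

Record houghton2 := Houghton2 {
  h2fun :> point -> point;
  _ : `[< bijective h2fun /\ eventual_translation h2fun >] }.

HB.instance Definition _ := [isSub for h2fun].
HB.instance Definition _ := [Choice of houghton2 by <:].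

Section HoughtonGroup.
Implicit Types (f g h : houghton2) (x : point).

Lemma h2_bij f : bijective f.
Proof. by case: f => f /= /asboolP[]. Qed.

Lemma h2_ev f : eventual_translation f.
Proof. by case: f => f /= /asboolP[]. Qed.

Lemma h2P f g : f =1 g -> f = g.
Proof. by move=> fg; apply: val_inj; apply/funext. Qed.

Definition mk_h2 (f : point -> point) (fb : bijective f)
  (fe : eventual_translation f) : houghton2 :=
  Houghton2 (asboolT (conj fb fe)).

Lemma ev_id : eventual_translation id.
Proof.
exists (fun=> 0%R).
rewrite [X in finite_set X](_ : _ = set0) //.
by rewrite -subset0 => x /=; case; rewrite addr0.
Qed.

Lemma ev_comp (f g : point -> point) : injective f ->
  eventual_translation f -> eventual_translation g ->
  eventual_translation (g \o f).
Proof.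
move=> fi [s fs] [t gt]; exists (fun b => s b + t b)%R.
apply: (@sub_finite_set _ _
  ([set x | ~ ((f x).2 = x.2 /\ ((f x).1%:Z = x.1%:Z + s x.2)%R)] `|`
   f @^-1` [set y | ~ ((g y).2 = y.2 /\ ((g y).1%:Z = y.1%:Z + t y.2)%R)])%classic).
  move=> x /= H; have [[f2 f1]|] := pselect ((f x).2 = x.2 /\
    ((f x).1%:Z = x.1%:Z + s x.2)%R); last by left.
  right=> -[g2 g1]; apply: H; rewrite g2 f2; split=> //.
  by rewrite g1 f1 f2 addrA.
rewrite finite_setU; split=> //.
apply: finite_preimage => //.
by move=> x y _ _; exact: fi.
Qed.

Lemma ev_inv (f g : point -> point) : cancel f g -> cancel g f ->
  eventual_translation f -> eventual_translation g.
Proof.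
move=> fgK gfK [s fs]; exists (fun b => - s b)%R.
apply: (@sub_finite_set _ _
  (g @^-1` [set x | ~ ((f x).2 = x.2 /\ ((f x).1%:Z = x.1%:Z + s x.2)%R)])%classic).
  move=> y /= H [f2 f1]; apply: H; rewrite !gfK in f2 f1.
  by rewrite f2 f1 addrK.
apply: finite_preimage => //.
by move=> x y _ _; exact: (can_inj gfK).
Qed.

Lemma h2_inv_subproof f : exists g : point -> point, cancel f g /\ cancel g f.
Proof. by case: (h2_bij f) => g *; exists g. Qed.

Definition h2_invfun f : point -> point := projT1 (cid (h2_inv_subproof f)).

Lemma h2_invfunK f : cancel f (h2_invfun f).
Proof. exact: (projT2 (cid (h2_inv_subproof f))).1. Qed.

Lemma h2_invfunVK f : cancel (h2_invfun f) f.
Proof. exact: (projT2 (cid (h2_inv_subproof f))).2. Qed.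

Definition h2_one : houghton2 := mk_h2 (inv_bij (fun=> erefl)) ev_id.

Definition h2_inv f : houghton2 :=
  mk_h2 (Bijective (h2_invfunVK f) (h2_invfunK f))
        (ev_inv (h2_invfunK f) (h2_invfunVK f) (h2_ev f)).

(* f * g is "f followed by g", as for the permutations of MathComp. *)
Definition h2_mul f g : houghton2 :=
  mk_h2 (bij_comp (h2_bij g) (h2_bij f))
        (ev_comp (bij_inj (h2_bij f)) (h2_ev f) (h2_ev g)).

Lemma h2_mulA : associative h2_mul. Proof. by move=> f g h; exact: h2P. Qed.
Lemma h2_mul1 : left_id h2_one h2_mul. Proof. by move=> f; exact: h2P. Qed.
Lemma h2_mulr1 : right_id h2_one h2_mul. Proof. by move=> f; exact: h2P. Qed.
Lemma h2_mulV : left_inverse h2_one h2_inv h2_mul.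
Proof. by move=> f; apply: h2P => x /=; rewrite h2_invfunVK. Qed.
Lemma h2_mulrV : right_inverse h2_one h2_inv h2_mul.
Proof. by move=> f; apply: h2P => x /=; rewrite h2_invfunK. Qed.

End HoughtonGroup.

HB.instance Definition _ :=
  isGroup.Build houghton2 h2_mulA h2_mul1 h2_mulr1 h2_mulV h2_mulrV.

Definition shift_fun (x : point) : point :=
  match x with
  | (0, false) => (0, true)
  | (k.+1, false) => (k, false)
  | (k, true) => (k.+1, true)
  end.

Definition unshift_fun (x : point) : point :=
  match x with
  | (0, true) => (0, false)
  | (k.+1, true) => (k, true)
  | (k, false) => (k.+1, false)
  end.

Lemma shift_funK : cancel shift_fun unshift_fun.
Proof. by move=> [[|[|k]] []]. Qed.

Lemma unshift_funK : cancel unshift_fun shift_fun.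
Proof. by move=> [[|[|k]] []]. Qed.

Lemma shift_ev : eventual_translation shift_fun.
Proof.
exists (fun b => if b then 1 else -1)%R.
apply: (@sub_finite_set _ _ [set (0, false)]%classic); last first.
  exact: finite_set1.
move=> [[|k] []] //= H; exfalso; apply: H; split=> //; lia.
Qed.

Definition h2_shift : houghton2 :=
  mk_h2 (Bijective shift_funK unshift_funK) shift_ev.

(* Exchanges -j and j, i.e. (j-1, 1) and (j-1, 2), for every 1 <= j <= k. *)
Definition flip_fun (k : nat) (x : point) : point :=
  if x.1 < k then (x.1, ~~ x.2) else x.

Lemma flip_funK k : involutive (flip_fun k).
Proof.
move=> [j b]; rewrite /flip_fun /=.
by case jk: (j < k); rewrite /= jk ?negbK.
Qed.

Lemma flip_ev k : eventual_translation (flip_fun k).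
Proof.
exists (fun=> 0%R).
apply: (@sub_finite_set _ _ (`I_k `*` [set: bool])%classic).
  move=> [j b] /= H; split=> //=; rewrite ltnNge; apply/negP => kj.
  by apply: H; rewrite /flip_fun /= ltnNge kj addr0.
by apply: finite_setX => //; exact: finite_II.
Qed.

(* The permutation part is an involution, so that there is no convention to fix
   on the side of its action.  The element h2_flip 1 = h2_sigma is not a dead end:
   its neighbour h2_sigma * h2_shift has length 2. *)
Definition h2_flip (k : nat) : houghton2 :=
  mk_h2 (inv_bij (flip_funK k)) (flip_ev k).

Definition sigma_fun (x : point) : point :=
  match x with
  | (0, b) => (0, ~~ b)
  | _ => x
  end.

Lemma sigma_funK : involutive sigma_fun.
Proof. by move=> [[|j] []]. Qed.

Lemma sigma_ev : eventual_translation sigma_fun.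
Proof.
have -> : sigma_fun = flip_fun 1 by apply/funext => -[[|j] b].
exact: flip_ev.
Qed.

Definition h2_sigma : houghton2 := mk_h2 (inv_bij sigma_funK) sigma_ev.

Lemma label_neq0 x : label x != 0%R.
Proof. by case: x => j [] /=. Qed.

Lemma label_inj : injective label.
Proof. by move=> [i []] [j []]; rewrite /label /= => ?; congr (_, _); lia. Qed.

Lemma label_shift x :
  label (h2_shift x) = (if label x == -1 then 1 else label x + 1)%R.
Proof. by case: x => [[|j] []]; rewrite /label /=; do ?case: ifPn; lia. Qed.

Lemma label_sigma x :
  label (h2_sigma x) = (if `|label x| == 1 then - label x else label x)%R.
Proof. by case: x => [[|j] []]; rewrite /label /=; do ?case: ifPn; lia. Qed.

Lemma label_flip k x :
  label (h2_flip k x) = (if `|label x| <= k%:Z then - label x else label x)%R.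
Proof.
case: x => j b; rewrite /label /= /flip_fun /=.
by case: ltnP => /= jk; case: b => /=; do ?case: ifPn; lia.
Qed.

(* Main.v *)
Require Import Defs.
From mathcomp Require Import all_boot.
From mathcomp Require Import all_order all_algebra zify boolp.
From mathcomp Require cardinality.

Set Implicit Arguments.
Unset Strict Implicit.
Unset Printing Implicit Defensive.

Import Order.TTheory GRing.Theory Num.Theory.

Local Open Scope group_scope.

(** An element h of H_2 is a rearrangement of particles on the integer line seen
from a cursor.  Number the points of the two rays by all of Z, so that s is the
translation z |-> z + 1 and sigma exchanges 0 and 1, and give a word in the
generators a cursor c in Z, decreased by s and increased by s^-1.  The position of
the particle x is the coordinate of h x plus c.  Multiplying h on the right by s
or s^-1 then leaves all positions unchanged and moves the cursor by one step, while
multiplying by sigma exchanges the particles in the positions c and c + 1.  So the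
length of h is the least number of moves and swaps that produce the arrangement.
The element g_k reverses the 2k particles in the positions 1 - k, ..., k and
returns the cursor to 0.

Lower bound (size_flip): a word for g_k has length at least L = 4k^2 - k - 2.
A swap creates at most one inversion, so there are at least k(2k - 1) swaps.  The
moves are counted by the thresholds that they cross: for 0 < q < k, a move crosses
q when it takes |c| from q - 1 to q or back, and no move crosses two thresholds.
The 2(k - q) particles that start outside the positions 1 - q, ..., q must all go
to the opposite side.  While the cursor stays between two crossings of q, a
suitable division of the line into a left, a central and a right zone has its
contents fixed, and at a crossing only one particle changes zone.  Each particle
goes through two changes of zone, so 4(k - q) crossings are needed; the first
crossing changes nothing useful, since the particle that it moves starts in the
centre, and the number of crossings is even, which makes it 4(k - q) + 2
(crossings_flip).  The sum over q is 2k^2 - 2.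

Upper bound (sort_from_edge, boxed_reach): suppose that only the particles of
1 - k, ..., k are out of place.  If the cursor is at an end of this range,
cocktail sort returns to the identity with at most 2k^2 - k swaps and one move
between two consecutive swaps, in at most 4k^2 - 2k - 1 = L - (k - 1) letters.
From any other |c| < k the nearer end is at most k - 1 moves away, hence length at
most L.

So g_k has length L and all its neighbours have length at most L.  A path from g_k
to an element of length greater than L has to leave the set of elements whose
particles outside 1 - k, ..., k are in place and whose cursor satisfies |c| < k.
It can do so only from a vertex with the cursor at an end of this range, whose
length is at most L - (k - 1) (leaving_box): the strong depth is at least k. *)

(** * Reaching a vertex by a bounded number of edges *)

Section Reach.
Variables (G : groupType) (X : seq G).
Implicit Types (g h v : G) (n m : nat).

(** Unlike cayley_dist, this is closed under composition of paths and needs no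
minimal path. *)
Definition reach n g h : Prop := exists2 p, edge_path X g p h & size p <= n.

Lemma cayley_edge_sym g h : cayley_edge X g h = cayley_edge X h g.
Proof. by rewrite /cayley_edge !invgM !invgK orbC. Qed.

Lemma reach_refl n g : reach n g g.
Proof. by exists [::]. Qed.

Lemma reach_edge g h : cayley_edge X g h -> reach 1 g h.
Proof. by move=> e; exists [:: h] => //; split; rewrite //= e. Qed.

Lemma reach_trans n m g h v : reach n g h -> reach m h v -> reach (n + m) g v.
Proof.
move=> [p [gp <-] sp] [q [hq <-] sq]; exists (p ++ q); last by rewrite size_cat leq_add.
by split; rewrite ?cat_path ?gp ?last_cat.
Qed.

Lemma reach_le n m g h : n <= m -> reach n g h -> reach m g h.
Proof. by move=> nm [p gp sp]; exists p => //; exact: leq_trans nm. Qed.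

Lemma reach_sym n g h : reach n g h -> reach n h g.
Proof.
move=> [p [gp <-] sp]; exists (rev (belast g p)); last by rewrite size_rev size_belast.
split; last by case: p {gp sp} => //= a p; rewrite rev_cons last_rcons.
by rewrite rev_path (eq_path (e' := cayley_edge X)) // => a b; rewrite cayley_edge_sym.
Qed.

Lemma cayley_ballP n g h : cayley_ball X g n%:Z%R h <-> reach n g h.
Proof.
split=> [[m [[p gp sp] _] mn]|[p gp sp]].
  by exists p => //; rewrite sp; lia.
have ex : exists m, `[< exists2 q, edge_path X g q h & size q = m >].
  by exists (size p); apply/asboolP; exists p.
case: (ex_minnP ex) => m /asboolP[q gq sq] mmin.
exists m; last by have := mmin _ (asboolT (ex_intro2 _ _ p gp erefl)); lia.
split; first by exists q.
by move=> r gr; apply: mmin; apply/asboolP; exists r.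
Qed.

End Reach.

(** * Particles and the cursor *)

Local Notation gens := [:: h2_shift; h2_sigma].

Lemma mulE (f g : houghton2) x : (f * g) x = g (f x).
Proof. by []. Qed.

(** Here -1 gets the coordinate 0, unlike in label, so that the shift is an honest
translation. *)
Definition coord (x : point) : int := (if x.2 then x.1.+1%:Z else - x.1%:Z)%R.

Definition point_at (z : int) : point :=
  if (0 < z)%R then ((absz z).-1, true) else (absz z, false).

Lemma point_atK : cancel point_at coord.
Proof. by move=> z; rewrite /point_at; case: ifPn; rewrite /coord /=; lia. Qed.

Lemma coord_inj : injective coord.
Proof. by move=> [i []] [j []]; rewrite /coord /= => ?; congr (_, _); lia. Qed.

Lemma coord_shift x : coord (h2_shift x) = (coord x + 1)%R.
Proof. by case: x => [[|j] []]; rewrite /coord /=; lia. Qed.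

Lemma coord_unshift x : coord (h2_shift^-1 x) = (coord x - 1)%R.
Proof.
have xE : h2_shift (h2_shift^-1 x) = x by exact: (h2_invfunVK h2_shift).
by rewrite -[in RHS]xE coord_shift addrK.
Qed.

Definition swap_at (c y : int) : int :=
  (if y == c then c + 1 else if y == c + 1 then c else y)%R.

Lemma coord_sigma x : coord (h2_sigma x) = swap_at 0 (coord x).
Proof. by case: x => [[|j] []]; rewrite /coord /swap_at /=; do ?case: ifPn; lia. Qed.

Lemma coord_flip k x :
  coord (h2_flip k x) = (if (x.1 < k)%N then 1 - coord x else coord x)%R.
Proof. by case: x => j []; rewrite /= /flip_fun /=; case: ifP; rewrite /coord /=; lia. Qed.

(** The translation length of h, which determines the cursor, is only asserted to
exist in the definition of H_2; c is an argument so as not to extract it. *)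
Definition position (h : houghton2) (c : int) (x : point) : int := (coord (h x) + c)%R.

Lemma position_inj h c : injective (position h c).
Proof. by move=> x y /addIr /coord_inj /(bij_inj (h2_bij h)). Qed.

Lemma position_shift h c x : position (h * h2_shift) (c - 1)%R x = position h c x.
Proof. by rewrite /position /= coord_shift; lia. Qed.

Lemma position_unshift h c x : position (h * h2_shift^-1) (c + 1)%R x = position h c x.
Proof. by rewrite /position [_ x]/= coord_unshift; lia. Qed.

Lemma position_sigma h c x :
  position (h * h2_sigma) c x = swap_at c (position h c x).
Proof. by rewrite /position /= coord_sigma /swap_at; do !case: eqP; lia. Qed.

Lemma h2_sigmaV : h2_sigma^-1 = h2_sigma.
Proof.
apply: h2P => x; apply: (bij_inj (h2_bij h2_sigma)).
rewrite [LHS](h2_invfunVK h2_sigma); symmetry; exact: sigma_funK.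
Qed.

Inductive letter := Sigma | Shift | Unshift.

Definition gen (l : letter) : houghton2 :=
  match l with
  | Sigma => h2_sigma | Shift => h2_shift | Unshift => h2_shift^-1
  end.

Lemma edgeP g h : cayley_edge gens g h <-> exists l, h = g * gen l.
Proof.
rewrite /cayley_edge; split=> [|[l ->]]; last first.
  by case: l; rewrite /= mulKg ?invgK !inE !eqxx ?orbT.
move=> H.
have {H} : [\/ g^-1 * h = h2_shift, g^-1 * h = h2_sigma,
            g^-1 * h = h2_shift^-1 | g^-1 * h = h2_sigma^-1].
  case/orP: H; rewrite !inE => /orP[]/eqP H.
  - exact: Or41.
  - exact: Or42.
  - by apply: Or43; rewrite -H invgK.
  - by apply: Or44; rewrite -H invgK.
by case=> H; [exists Shift | exists Sigma | exists Unshift | exists Sigma];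
  rewrite -(mulVKg g h) H ?h2_sigmaV.
Qed.

(** * Words *)

(** The last letter is the head of the list, so that structural recursion follows
the multiplication on the right. *)
Fixpoint eval (w : seq letter) : houghton2 :=
  if w is l :: w' then eval w' * gen l else 1.

Definition move_cursor (l : letter) (c : int) : int :=
  match l with Sigma => c | Shift => c - 1 | Unshift => c + 1 end%R.

Fixpoint cursor (w : seq letter) : int :=
  if w is l :: w' then move_cursor l (cursor w') else 0%R.

Definition word_position (w : seq letter) : point -> int :=
  position (eval w) (cursor w).

Lemma word_position_cons l w x :
  word_position (l :: w) x =
  if l is Sigma then swap_at (cursor w) (word_position w x) else word_position w x.
Proof.
case: l; rewrite /word_position; first exact: position_sigma.
- exact: position_shift.
- exact: position_unshift.
Qed.

Lemma word_position_nil x : word_position [::] x = coord x.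
Proof. exact: addr0. Qed.

Lemma path_word p h : edge_path gens 1 p h -> exists2 w, size w = size p & eval w = h.
Proof.
elim/last_ind: p h => [|p v IH] h [].
  by move=> _ <-; exists [::].
rewrite rcons_path last_rcons => /andP[pp /edgeP[l vE]] <-.
have [w sw ew] := IH _ (conj pp erefl).
by exists (l :: w); rewrite ?size_rcons /= ?sw // ew vE.
Qed.

Lemma normr_cursor w : (`|cursor w| <= (size w)%:Z)%R.
Proof. by elim: w => //= -[] w /=; lia. Qed.

Lemma word_position_far w x : size w < x.1 -> word_position w x = coord x.
Proof.
elim: w => [|l w IH] xw; first exact: word_position_nil.
have /IH {}IH : size w < x.1 by rewrite (leq_ltn_trans _ xw).
rewrite word_position_cons IH; case: l xw => // xw.
have := normr_cursor w; move: xw; rewrite /swap_at /coord /=.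
by case: x {IH} => j [] /=; do !case: eqP; lia.
Qed.

(** The cursor of a word depends only on its value: it is the translation by which
the value moves a point far away, as a word cannot move distant particles. *)
Lemma cursor_flip w k : eval w = h2_flip k -> cursor w = 0%R.
Proof.
move=> wE; pose x : point := ((size w + k).+1, true).
have := @word_position_far w x; rewrite /word_position wE /position coord_flip.
by rewrite ifF; [move/(_ ltac:(rewrite /=; lia)); lia | rewrite /=; lia].
Qed.

Lemma coord_eval_bound w x : (coord (eval w x) <= coord x + (size w)%:Z)%R.
Proof.
elim: w => [|l w]; first by rewrite addr0.
by case: l; rewrite /= ?coord_sigma ?coord_shift ?coord_unshift /swap_at;
  do ?case: eqP; lia.
Qed.

(** * The number of swaps *)

Section Inversions.
Variable T : finType.
Implicit Types (f g : T -> int).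

Definition inversions (home f : T -> int) : nat :=
  #|[pred uv : T * T | (home uv.1 < home uv.2)%R && (f uv.2 < f uv.1)%R]|.

(** Only the pair of particles in the positions c and c + 1 changes its order. *)
Lemma inversions_swap home f c : injective f ->
  inversions home (swap_at c \o f) <= (inversions home f).+1.
Proof.
move=> fi; rewrite -addn1.
pose D := [pred uv : T * T | (f uv.1 == c) && (f uv.2 == (c + 1)%R)].
have D1 : #|D| <= 1.
  apply/card_le1P => -[u v] /andP[/= /eqP fu /eqP fv] [u' v']; rewrite !inE /=.
  apply/andP/eqP => [[/eqP fu' /eqP fv']|[-> ->]]; last by rewrite fu fv.
  by congr (_, _); apply: fi; rewrite ?fu ?fv.
apply: leq_trans (leq_add (leqnn _) D1).
rewrite -cardUI; apply: leq_trans (leq_addr _ _); apply: subset_leq_card.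
apply/subsetP => -[u v]; rewrite !inE /= => /andP[-> /=]; rewrite /swap_at.
by do !case: eqP => /=; lia.
Qed.

Lemma inversions_id f : inversions f f = 0.
Proof. by apply: eq_card0 => uv; apply/negP => /andP[]; lia. Qed.

(** A pair of distinct particles is ordered in one of two ways, and the reversal
inverts all of them: 2I + n = n^2. *)
Lemma inversions_opp f (c : int) : injective f ->
  ((inversions f (fun u => c - f u)%R).*2 + #|T| = #|T| ^ 2)%N.
Proof.
move=> fi.
have -> : inversions f (fun u => c - f u)%R = #|[pred uv : T * T | (f uv.1 < f uv.2)%R]|.
  by apply: eq_card => uv; rewrite !inE ltrD2l ltrN2 andbb.
set A := [pred uv | _].
pose B := [pred uv : T * T | (f uv.2 < f uv.1)%R].
pose C := [pred uv : T * T | uv.1 == uv.2].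
have AB : #|B| = #|A|.
  have sw : bijective (fun uv : T * T => (uv.2, uv.1)).
    by exists (fun uv => (uv.2, uv.1)) => -[].
  by rewrite -(on_card_preimset (onW_bij _ sw)); apply: eq_card => -[u v]; rewrite !inE.
have CT : #|C| = #|T|.
  rewrite -(card_codom (f := fun u : T => (u, u))); last by move=> u v [].
  apply: eq_card => -[u v]; rewrite !inE /=; apply/eqP/codomP => [->|[w [-> ->]] //].
  by exists v.
have cardE (P : pred (T * T)) : #|P| = (\sum_uv P uv)%N.
  by rewrite -sum1_card big_mkcond.
rewrite -mulnn -card_prod -addnn -CT -{2}AB !cardE -!big_split /=.
apply: eq_bigr => -[u v] _; rewrite /=.
by case: ltgtP => [uv|uv|/fi ->]; rewrite ?eqxx //;
  case: eqP => // uE; rewrite uE ltxx in uv.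
Qed.
End Inversions.

Fixpoint swaps (w : seq letter) : nat :=
  if w is l :: w' then ((if l is Sigma then 1 else 0) + swaps w')%N else 0%N.

(** * The number of moves *)

Definition inner (q : nat) (c : int) : bool := (`|c| < q%:Z)%R.

Fixpoint crossings (q : nat) (w : seq letter) : nat :=
  if w is l :: w'
  then ((inner q (cursor w') != inner q (move_cursor l (cursor w'))) + crossings q w')%N
  else 0%N.

Lemma odd_crossings q w : 0 < q -> odd (crossings q w) = ~~ inner q (cursor w).
Proof.
move=> q0; elim: w => [|l w IH] /=; first by rewrite /inner normr0 ltz_nat q0.
by rewrite oddD IH oddb; do 2 case: inner.
Qed.

(** The only threshold that a move from c to c' can cross is the greater of |c| and
|c'|. *)
Lemma one_threshold k c c' : (`|c' - c| <= 1)%R ->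
  \sum_(1 <= q < k) (inner q c != inner q c') <= 1.
Proof.
move=> cc'; pose m := maxn (absz c) (absz c').
apply: (@leq_trans (\sum_(1 <= q < k) (q == m))).
  by apply: leq_sum => q _; rewrite /inner /m; do ?case: eqP; lia.
by rewrite -big_mkcond /= sum1_count (count_uniq_mem m (iota_uniq _ _)) leq_b1.
Qed.

Lemma size_crossings k w : swaps w + \sum_(1 <= q < k) crossings q w <= size w.
Proof.
elim: w => [|l w IH]; first by rewrite big1.
rewrite /= big_split /= addnACA; apply: (@leq_add _ _ 1) => //.
by case: l => /=; [rewrite big1 // => q _; rewrite eqxx | apply: one_threshold; lia..].
Qed.

Lemma inversions_swaps (T : finType) (u : T -> point) w : injective u ->
  inversions (coord \o u) (word_position w \o u) <= swaps w.
Proof.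
move=> ui; elim: w => [|l w IH].
  rewrite (_ : word_position [::] \o u = coord \o u) ?inversions_id //.
  by apply/funext => i; exact: word_position_nil.
have -> : word_position (l :: w) \o u =
  if l is Sigma then swap_at (cursor w) \o (word_position w \o u)
  else word_position w \o u.
  by apply/funext => i; rewrite /= word_position_cons; case: l.
case: l => //=; rewrite add1n; apply: leq_trans (inversions_swap _ _ _) _ => //.
exact: inj_comp (@position_inj _ _) ui.
Qed.

(** The zone of the position y: 0 on the left, 1 in the centre, 2 on the right.  When
the cursor is inner, the centre is 1 - q, ..., q.  When the cursor is further to
the left, it exchanges particles in positions up to 1 - q, so that this position is
given to the left zone; likewise q is given to the right zone when the cursor is
further to the right.  Thus no swap takes a particle to another zone. *)
Definition zone (q : nat) (c y : int) : nat :=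
  ((- q%:Z + (c <= - q%:Z)%R%:Z < y)%R + (q.+1%:Z - (q%:Z <= c)%R%:Z <= y)%R)%N.

Lemma zone_swap_at q c y : 0 < q -> zone q c (swap_at c y) = zone q c y.
Proof. by move=> q0; rewrite /zone /swap_at; do !case: eqP; lia. Qed.

Lemma zone_inner q c c' y : 0 < q -> (`|c' - c| <= 1)%R ->
  inner q c = inner q c' -> zone q c y = zone q c' y.
Proof. by rewrite /zone /inner; lia. Qed.

(** The particles of 1 - k, ..., k outside the centre 1 - q, ..., q; they start in the
left zone if u.2 is false and in the right zone if u.2 is true. *)
Definition outer_point (q k : nat) (u : 'I_(k - q) * bool) : point := (q + u.1, u.2).

Lemma outer_point_inj q k : injective (@outer_point q k).
Proof. by move=> [i b] [j b'] [/addnI/val_inj -> ->]. Qed.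

(** The total distance, counted in zones, of the outer particles from the zone
where they start. *)
Definition misplacement (q k : nat) (c : int) (f : point -> int) : nat :=
  \sum_(u : 'I_(k - q) * bool)
    (if u.2 then 2 - zone q c (f (outer_point u)) else zone q c (f (outer_point u))).

(** When the cursor crosses the threshold, one boundary of the zones moves by one, and
only the particle in one position y0 is affected. *)
Lemma misplacement_cross q k c c' (f : point -> int) : 0 < q -> (`|c' - c| <= 1)%R ->
  injective f -> misplacement q k c' f <= (misplacement q k c f).+1.
Proof.
move=> q0 cc' fi; rewrite /misplacement.
have [y0 zoneE] : exists y0, forall y,
    zone q c' y <= zone q c y + (y == y0) /\ zone q c y <= zone q c' y + (y == y0).
  (* 1 - q when the crossing is on the left, q when it is on the right *)
  exists (if (Order.min c c' < 0)%R then - q%:Z + 1 else q%:Z)%R => y.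
  by rewrite /zone; case: ifP; case: eqP; lia.
have le1 : \sum_(u : 'I_(k - q) * bool) (f (outer_point u) == y0) <= 1.
  rewrite -big_mkcond (sum1_card [pred u | f (outer_point u) == y0]).
  apply/card_le1P => u; rewrite inE => /eqP fu v; rewrite !inE /=.
  apply/eqP/eqP => [fv|->] //; apply: (@outer_point_inj q k); apply: fi.
  by rewrite fu fv.
apply: leq_trans (_ : _ <= misplacement q k c f + _) _; last first.
  by rewrite -[leqRHS]addn1 leq_add2l; exact: le1.
rewrite -big_split /=.
by apply: leq_sum => u _; have := zoneE (f (outer_point u)); case: u.2; lia.
Qed.

(** The inequality is strict once a crossing has taken place, because the first one
transfers a particle of the centre, which is not outer.  The first alternative
describes the time before it. *)
Lemma misplacement_crossings q k w : 0 < q -> q < k ->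
  [/\ crossings q w = 0, forall j, q <= j -> (word_position w (j, false) <= - q%:Z)%R
    & forall j, q <= j -> (q%:Z < word_position w (j, true))%R] \/
  misplacement q k (cursor w) (word_position w) < crossings q w.
Proof.
move=> q0 qk; elim: w => [|l w IH].
  by left; split=> // j qj; rewrite word_position_nil /coord /=; lia.
have step : (`|move_cursor l (cursor w) - cursor w| <= 1)%R by case: l => /=; lia.
pose same := inner q (cursor w) == inner q (move_cursor l (cursor w)).
have [[E0 fB fT]|lt] := IH.
  have inw : inner q (cursor w).
    by apply/negPn; rewrite -odd_crossings // E0.
  have fB' j : q <= j -> (word_position (l :: w) (j, false) <= - q%:Z)%R.
    move=> /fB; rewrite word_position_cons; case: l {step same} => //.
    by move: inw; rewrite /inner /swap_at; do !case: eqP; lia.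
  have fT' j : q <= j -> (q%:Z < word_position (l :: w) (j, true))%R.
    move=> /fT; rewrite word_position_cons; case: l {step same fB'} => //.
    by move: inw; rewrite /inner /swap_at; do !case: eqP; lia.
  rewrite /= E0 addn0; have [s|s] := boolP same.
    by left; split=> //; rewrite -/same s.
  right; rewrite -/same s /misplacement big1 // => -[i b] _ /=.
  have := fB' _ (leq_addr i q); have := fT' _ (leq_addr i q).
  move: s; rewrite /same inw /inner /outer_point /zone /=.
  by case: b => /=; lia.
right; rewrite /=.
pose M := misplacement q k (cursor w) (word_position w).
apply: (@leq_ltn_trans (M + ~~ same)); last by rewrite /same addnC ltn_add2l.
have -> : misplacement q k (move_cursor l (cursor w)) (word_position (l :: w)) =
          misplacement q k (move_cursor l (cursor w)) (word_position w).
  apply: eq_bigr => u _; rewrite word_position_cons.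
  by case: l {step same} => //=; rewrite zone_swap_at.
have [/eqP s|s] := boolP same; last first.
  by rewrite addn1; apply: misplacement_cross => //; exact: position_inj.
rewrite addn0 leq_eqVlt; apply/orP; left; apply/eqP.
by apply: eq_bigr => u _; rewrite (zone_inner _ q0 step s).
Qed.

(** All 2(k - q) outer particles end up two zones away, so there are more than
4(k - q) crossings, and the parity adds one more. *)
Lemma crossings_flip q k w : 0 < q -> q < k -> eval w = h2_flip k ->
  (4 * (k - q) + 2 <= crossings q w)%N.
Proof.
move=> q0 qk wE; have c0 := cursor_flip wE.
have posE j b : q <= j < k -> word_position w (j, b) = (1 - coord (j, b))%R.
  by case/andP=> _ jk; rewrite /word_position wE c0 /position addr0 coord_flip jk.
have := odd_crossings w q0; rewrite c0 /inner normr0 ltz_nat q0 /= => Eodd.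
have [[_ /(_ q (leqnn q)) + _]|] := misplacement_crossings w q0 qk.
  by rewrite posE ?leqnn // /coord /=; lia.
rewrite /misplacement (eq_bigr (fun=> 2)) => [|[i b] _]; last first.
  have ik := ltn_ord i; rewrite /outer_point /= posE; last by lia.
  by rewrite c0 /zone /coord; case: b => /=; lia.
by rewrite sum_nat_const card_prod card_ord card_bool; lia.
Qed.

Lemma size_flip k w : 1 < k -> eval w = h2_flip k -> (4 * k ^ 2 - k - 2 <= size w)%N.
Proof.
move=> k1 wE; apply: leq_trans (size_crossings k w).
have cr : (2 * k ^ 2 - 2 <= \sum_(1 <= q < k) crossings q w)%N.
  apply: (@leq_trans (\sum_(1 <= q < k) (4 * (k - q) + 2)%N)).
    rewrite big_nat_rev /= (eq_big_nat _ _ (F2 := fun q => 4 * q + 2)%N) => [|q];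
      last by lia.
    case: k k1 {wE} => // k _; elim: k => [|k IH]; first by rewrite big_geq.
    by rewrite big_nat_recr //=; lia.
  rewrite big_nat_cond [X in _ <= X]big_nat_cond.
  apply: leq_sum => q /andP[/andP[q0 qk] _].
  exact: crossings_flip.
pose u (i : 'I_k * bool) : point := (i.1 : nat, i.2).
have ui : injective u by move=> [i b] [j b'] [/val_inj -> ->].
pose I := inversions (coord \o u) (fun i => 1 - (coord \o u) i)%R.
have sw : I <= swaps w.
  apply: leq_trans (inversions_swaps w ui); rewrite leq_eqVlt; apply/orP; left; apply/eqP.
  congr inversions; apply/funext => i.
  by rewrite /= /word_position wE (cursor_flip wE) /position addr0 coord_flip ltn_ord.
have : (I.*2 + k * 2 = 4 * k ^ 2)%N.
  have := inversions_opp 1%R (inj_comp coord_inj ui).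
  by rewrite card_prod card_ord card_bool expnMn [RHS]mulnC.
by move: (\sum_(1 <= q < k) _) cr sw => C; move: I => I; lia.
Qed.

(** * Sorting with the cursor *)

Definition settled (h : houghton2) (lo hi c : int) : Prop :=
  forall x, ~~ (lo <= coord x <= hi)%R -> position h c x = coord x.

(** The particles out of place occupy the same positions as at the start, since h is
a bijection. *)
Lemma settled_position h lo hi c x : settled h lo hi c ->
  (lo <= coord x <= hi)%R -> (lo <= position h c x <= hi)%R.
Proof.
move=> hs xin; apply/negPn/negP => xout.
pose y := point_at (position h c x).
have yE : coord y = position h c x by exact: point_atK.
have /position_inj yx : position h c y = position h c x by rewrite -[RHS]yE hs ?yE.
by move: xout; rewrite -yE yx xin.
Qed.

Lemma settled_shift h lo hi c :
  settled h lo hi c -> settled (h * h2_shift) lo hi (c - 1)%R.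
Proof. by move=> hs x /hs; rewrite position_shift. Qed.

Lemma settled_unshift h lo hi c :
  settled h lo hi c -> settled (h * h2_shift^-1) lo hi (c + 1)%R.
Proof. by move=> hs x /hs; rewrite position_unshift. Qed.

Lemma settled_sigma h lo hi c : (lo <= c < hi)%R ->
  settled h lo hi c -> settled (h * h2_sigma) lo hi c.
Proof.
move=> cin hs x xout; rewrite position_sigma hs // /swap_at.
by do !case: eqP => ?; move: xout; lia.
Qed.

Lemma reach_gen l h : reach gens 1 h (h * gen l).
Proof. by apply/reach_edge/edgeP; exists l. Qed.

Lemma reach_shifts n h c lo hi : settled h lo hi c ->
  exists2 h', reach gens n h h' & settled h' lo hi (c - n%:Z)%R.
Proof.
elim: n h c => [|n IH] h c hs.
  by exists h; [exact: reach_refl | rewrite subr0].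
have [h' r hs'] := IH _ _ (settled_shift hs).
exists h'; first exact: (reach_trans (reach_gen Shift h) r).
by move: hs'; rewrite -addrA -opprD -intS.
Qed.

Lemma swap_towards h lo hi c x : (lo <= c < hi)%R -> settled h lo hi c ->
  (position h c x <= c + 1)%R ->
  exists h', [/\ reach gens 1 h h', settled h' lo hi c & (position h' c x <= c)%R].
Proof.
move=> cin hs; rewrite le_eqVlt => /predU1P[xc|xc].
  exists (h * h2_sigma); split; [exact: (reach_gen Sigma) | exact: settled_sigma |].
  by rewrite position_sigma xc /swap_at; do !case: eqP; lia.
by exists h; split=> //; [exact: reach_refl | lia].
Qed.

(** One pass of the sort.  The cursor goes left; from the moment it meets the particle
lo it carries it along, swapping once before each move. *)
Lemma carry_left n h lo hi c : c = (lo + n%:Z)%R -> (c < hi)%R -> settled h lo hi c ->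
  (position h c (point_at lo) <= c + 1)%R ->
  exists2 h', reach gens (n.*2 + 1) h h' & settled h' (lo + 1)%R hi lo.
Proof.
elim: n h c => [|n IH] h c cE chi hs xc.
  rewrite addr0 in cE; subst c.
  have [|h' [r hs' xc']] := swap_towards _ hs xc; first by lia.
  exists h' => // x xout; have [xlo|xlo] := eqVneq (coord x) lo.
    have xE : x = point_at lo by apply: coord_inj; rewrite point_atK.
    by have := settled_position (x := x) hs'; move: xc'; rewrite -xE; lia.
  by apply: hs'; lia.
have [|h1 [r1 hs1 xc1]] := swap_towards _ hs xc; first by lia.
have [||||h' r hs'] := IH (h1 * h2_shift) (c - 1)%R; [lia | lia | | |].
- exact: settled_shift.
- by rewrite position_shift; lia.
exists h' => //; apply: reach_le (reach_trans r1 (reach_trans (reach_gen Shift h1) r)).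
lia.
Qed.

(** The reflection z |-> 1 - z induces an automorphism of H_2 that inverts the shift
and fixes sigma; it turns passes to the left into passes to the right. *)
Definition mirror_fun (x : point) : point := (x.1, ~~ x.2).

Lemma mirror_funK : involutive mirror_fun.
Proof. by case=> j b; rewrite /mirror_fun negbK. Qed.

Lemma coord_mirror x : coord (mirror_fun x) = (1 - coord x)%R.
Proof. by case: x => j []; rewrite /coord /=; lia. Qed.

Lemma mirror_ev (h : houghton2) : eventual_translation (mirror_fun \o h \o mirror_fun).
Proof.
have [s hs] := h2_ev h; exists (fun b => s (~~ b)).
have := cardinality.finite_preimage (f := mirror_fun) (in2W (can_inj mirror_funK)) hs.
apply: cardinality.sub_finite_set => x /= H [h2 h1]; apply: H; split=> //.
by rewrite h2 negbK.
Qed.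

Definition mirror (h : houghton2) : houghton2 :=
  mk_h2 (bij_comp (bij_comp (inv_bij mirror_funK) (h2_bij h)) (inv_bij mirror_funK))
        (mirror_ev h).

Lemma mirrorE h x : mirror h x = mirror_fun (h (mirror_fun x)).
Proof. by []. Qed.

Lemma mirrorK : involutive mirror.
Proof. by move=> h; apply: h2P => x /=; rewrite !mirror_funK. Qed.

Lemma mirror1 : mirror 1 = 1.
Proof. by apply: h2P => x /=; rewrite mirror_funK. Qed.

Lemma settled_mirror h lo hi c : settled h lo hi c ->
  settled (mirror h) (1 - hi)%R (1 - lo)%R (- c)%R.
Proof.
move=> hs x xout; have := hs (mirror_fun x); rewrite /position /= !coord_mirror; lia.
Qed.

Lemma reach_mirror n g h : reach gens n g h -> reach gens n (mirror g) (mirror h).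
Proof.
move=> [p [gp <-] sp]; exists (map mirror p); last by rewrite size_map.
split; last by rewrite last_map.
apply: homo_path gp => a b /edgeP[l ->]; apply/edgeP.
exists (match l with Sigma => Sigma | Shift => Unshift | Unshift => Shift end).
apply: h2P => x; apply: coord_inj.
rewrite mirrorE !mulE mirrorE coord_mirror.
by case: l; rewrite /gen !(coord_sigma, coord_shift, coord_unshift) coord_mirror /swap_at;
  do ?case: eqP; lia.
Qed.

Lemma reach1_mirror n h : reach gens n (mirror h) 1 -> reach gens n h 1.
Proof. by move/reach_mirror; rewrite mirrorK mirror1. Qed.

Lemma carry_left_end n h lo hi : hi = (lo + n.+1%:Z)%R -> settled h lo hi (hi - 1)%R ->
  exists2 h', reach gens (n.*2 + 1) h h' & settled h' (lo + 1)%R hi lo.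
Proof.
move=> hiE hs; apply: (@carry_left n h lo hi (hi - 1)%R) => //; [lia | lia |].
by have := settled_position (x := point_at lo) hs; rewrite point_atK; lia.
Qed.

(** A pass that settles the particle lo, a move, and the reflection that brings the
remaining particles to the initial situation, with the cursor at the right end. *)
Lemma sort_step n m h lo hi : hi = (lo + n.+1%:Z)%R -> settled h lo hi (hi - 1)%R ->
  (forall h', settled h' (1 - hi) (- lo) (- lo - 1)%R -> reach gens m h' 1) ->
  reach gens (n.*2 + 2 + m) h 1.
Proof.
move=> hiE hs next; have [h1 r1 hs1] := carry_left_end hiE hs.
have := settled_mirror hs1; rewrite opprD addrCA subrr addr0 => /settled_shift /next r2.
rewrite (_ : _ + m = n.*2 + 1 + (1 + m))%N; last by lia.
apply: reach_trans r1 (reach1_mirror _).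
exact: reach_trans (reach_gen Shift _) r2.
Qed.

(** Each induction step makes one pass in each direction; the two passes take the
range - j, ..., j + 1 to 1 - j, ..., j, which keeps it symmetric about the cursor 0,
where the sort has to end. *)
Lemma sort_from_edge j h : settled h (- j%:Z)%R (j%:Z + 1)%R j%:Z ->
  reach gens (4 * j.+1 ^ 2 - 2 * j.+1 - 1)%N h 1.
Proof.
elim: j h => [|j IH] h hs.
  have [||h' r hs'] := @carry_left_end 0 h 0%R 1%R; [by [] | exact: hs |].
  suff -> : 1 = h' by [].
  have pos y : coord y != 1%R -> coord (h' y) = coord y.
    by move=> y1; have := hs' y; rewrite /position addr0; apply; lia.
  apply: h2P => x /=; apply: coord_inj; have [x1|/pos //] := eqVneq (coord x) 1%R.
  rewrite x1; apply/esym/eqP/negPn/negP => hx.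
  by have /coord_inj/(bij_inj (h2_bij h')) hxx := pos _ hx; rewrite hxx x1 in hx.
have nE : (4 * j.+2 ^ 2 - 2 * j.+2 - 1 =
    j.+1.*2.*2 + 2 + (j.*2.+1.*2 + 2 + (4 * j.+1 ^ 2 - 2 * j.+1 - 1)))%N by lia.
rewrite nE; apply: (sort_step _ (lo := - j.+1%:Z) (hi := j.+1%:Z + 1)%R).
- lia.
- by rewrite addrK.
move=> h1 hs1; apply: (sort_step _ (lo := - j.+1%:Z) (hi := j.+1%:Z)%R).
- lia.
- by move: hs1; congr settled; lia.
by move=> h2 hs2; apply: IH; move: hs2; congr settled; lia.
Qed.

(** * Lengths near the flip and the depth *)

Definition boxed (k : nat) (h : houghton2) (c : int) : Prop :=
  settled h (1 - k%:Z)%R k%:Z c /\ (`|c| < k%:Z)%R.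

Lemma boxed_reach_edge k h c : boxed k h c ->
  reach gens (4 * k ^ 2 - 2 * k - 1 + (k.-1 - `|c|))%N 1 h.
Proof.
move=> [hs ck]; apply: reach_sym.
wlog c0 : h c hs ck / (c <= 0)%R => [wl|].
  have [|c0] := lerP c 0%R; first exact: wl.
  apply: reach1_mirror; rewrite -abszN; apply: wl; [|lia|lia].
  by have := settled_mirror hs; congr settled; lia.
have [h' r hs'] := reach_shifts (k.-1 - absz c) hs.
rewrite addnC; apply: reach_trans r (reach1_mirror _).
case: k hs hs' ck => [|j] hs hs' ck; first by lia.
by apply: sort_from_edge; have := settled_mirror hs'; congr settled; lia.
Qed.

Lemma boxed_reach k h c : 0 < k -> boxed k h c -> reach gens (4 * k ^ 2 - k - 2)%N 1 h.
Proof. by move=> k0 /boxed_reach_edge; apply: reach_le; nia. Qed.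

Lemma boxed_flip k : 0 < k -> boxed k (h2_flip k) 0.
Proof.
move=> k0; split; last by rewrite normr0.
move=> [j b]; rewrite /position addr0 coord_flip.
by case: ltnP; rewrite /coord; case: b => /=; lia.
Qed.

Lemma boxed_step k h c l : boxed k h c -> (`|move_cursor l c| < k%:Z)%R ->
  boxed k (h * gen l) (move_cursor l c).
Proof.
case: l => -[hs ck] ck'; split=> //.
- by apply: settled_sigma => //=; lia.
- exact: settled_shift.
- exact: settled_unshift.
Qed.

(** A swap or a move keeping |c| < k stays among the boxed elements; the vertex from
which the path leaves them has its cursor at an end, where the bound of
boxed_reach_edge is the best. *)
Lemma leaving_box k p g h c : 0 < k -> boxed k g c -> edge_path gens g p h ->
  ~ reach gens (4 * k ^ 2 - k - 2)%N 1 h ->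
  exists2 v, v \in g :: p & reach gens (4 * k ^ 2 - 2 * k - 1)%N 1 v.
Proof.
move=> k0; elim: p g c => [|v p IH] g c gb [] /=.
  by move=> _ <- []; exact: boxed_reach gb.
move=> /andP[/edgeP[l vE] vp] ph hfar; rewrite {}vE in vp ph *.
have [ck|ck] := ltrP `|move_cursor l c|%R k%:Z%R.
  have [v' v'p r] := IH _ _ (boxed_step gb ck) (conj vp ph) hfar.
  by exists v' => //; rewrite inE v'p orbT.
exists g; first exact: mem_head.
have := boxed_reach_edge gb; rewrite (_ : k.-1 - absz c = 0)%N ?addn0 //.
by case: gb => _; case: l ck {vp ph} => /=; lia.
Qed.

Lemma reach_word n h : reach gens n 1 h -> exists2 w, size w <= n & eval w = h.
Proof. by case=> p /path_word[w <- wE] sp; exists w. Qed.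

Lemma cayley_dist_flip k : 1 < k ->
  cayley_dist gens 1 (h2_flip k) (4 * k ^ 2 - k - 2)%N.
Proof.
move=> k1; have lb p : edge_path gens 1 p (h2_flip k) -> (4 * k ^ 2 - k - 2 <= size p)%N.
  by case/path_word=> w <-; exact: size_flip.
split=> //; have [||p gp sp] := @boxed_reach k (h2_flip k) 0.
- exact: ltnW.
- exact/boxed_flip/ltnW.
by exists p => //; apply/eqP; rewrite eqn_leq sp lb.
Qed.

(** Shifting n + 1 times moves distant points by n + 1, more than a word of length n
can. *)
Lemma boxed_escape n k h c : boxed k h c -> (c <= 0)%R ->
  exists2 h', reach gens n.+1 h h' & ~ reach gens n 1 h'.
Proof.
move=> [hs _] c0; have [h' r hs'] := reach_shifts n.+1 hs.
exists h' => // /reach_word[w sw wE].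
have := coord_eval_bound w (k, true); have := hs' (k, true).
by rewrite wE /position /coord /=; lia.
Qed.

Theorem corollary10 (k : nat) (hk : 1 < k) :
  dead_end [:: h2_shift; h2_sigma] (h2_flip k) /\
  exists2 m : nat, strong_depth [:: h2_shift; h2_sigma] (h2_flip k) m & k <= m.
Proof.
have k0 := ltnW hk; have gb := boxed_flip k0; have gd := cayley_dist_flip hk.
set L := (4 * k ^ 2 - k - 2)%N in gd.
split.
  exists L => // h /cayley_ballP [[|v [|//]] [/= gp <-] _]; apply/cayley_ballP.
    exact: boxed_reach gb.
  move: gp; rewrite andbT => /edgeP[l ->].
  by apply: boxed_reach (boxed_step gb _) => //; case: l => /=; lia.
have esc : exists m, `[< escapes gens (h2_flip k) L m >].
  exists L.+1; apply/asboolP.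
  have [h [p gp _] hfar] := boxed_escape L gb (lexx 0%R).
  exists p, h; split=> //; first by move/cayley_ballP.
  by move=> v _ [n _]; lia.
case: (ex_minnP esc) => m /asboolP mesc mmin; exists m.
  by exists L => //; split=> // m' m'esc; apply: mmin; apply/asboolP.
have [p [h [gp hfar pfar]]] := mesc.
have [|v vp r] := leaving_box k0 gb gp; first by move/cayley_ballP.
rewrite leqNgt; apply/negP => mk; apply: (pfar v vp).
have [n nd nle] := (cayley_ballP _ _ _ _).2 r.
by exists n => //; move: nle; rewrite /L; nia.
Qed.
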